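(* For all positive integers $m$ and $n$, the number $D_P^{(m,n)}$ of period knot $(m,n)$-mosaics is $$ D_{P}^{(m,n)} = \mathrm{tr}\big((X_m^+ + O_m^+)^n\big), $$ where $X_m^+$ and $O_m^+$ are the $2^m \times 2^m$ matrices defined by the recursion (in block form) $$ X_{k+1}^+ = \begin{bmatrix} X_k^+ & O_k^- \\ O_k^- & X_k^+ \end{bmatrix}, \qquad X_{k+1}^- = \begin{bmatrix} X_k^- & O_k^+ \\ O_k^+ & X_k^- \end{bmatrix}, $$ $$ O_{k+1}^+ = \begin{bmatrix} O_k^+ & X_k^- \\ X_k^- & 4\, O_k^+ \end{bmatrix}, \qquad O_{k+1}^- = \begin{bmatrix} O_k^- & X_k^+ \\ X_k^+ & 4\, O_k^- \end{bmatrix} $$ for $k=0,1,\dots,m-1$, starting with the $1\times 1$ matrices $X_0^+ = O_0^+ = \begin{bmatrix} 1 \end{bmatrix}$ and $X_0^- = O_0^- = \begin{bmatrix} 0 \end{bmatrix}$.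
   Context: Mosaic tiles: there are eleven tiles $T_0,\dots,T_{10}$ (unit squares with curves drawn on them). A connection point of a tile is the midpoint of an edge (left, right, top, bottom) of the tile that is an endpoint of a curve drawn on the tile. The sets of edges carrying connection points are as follows: $T_0$: none; $T_1$: left, bottom; $T_2$: right, bottom; $T_3$: right, top; $T_4$: left, top; $T_5$: left, right; $T_6$: top, bottom; $T_7,T_8,T_9,T_{10}$: all four edges. Thus each two-element set of edges occurs for exactly one tile, the empty set for exactly one tile, and the full set for exactly four tiles. For positive integers $m,n$, an $(m,n)$-mosaic is an $m\times n$ matrix $M=(M_{ij})$ of mosaic tiles (row 1 at the top, column 1 at the left). It is suitably connected if any two tiles immediately next to each other in the same row or the same column either both have or both do not have a connection point on their common edge. It is suitably $\partial$-connected if for each row, the leftmost tile has a connection point on its left edge if and only if the rightmost tile has one on its right edge, and for each column, the topmost tile has a connection point on its top edge if and only if the bottommost tile has one on its bottom edge (when $n=1$ or $m=1$ the two tiles in question coincide). A period knot $(m,n)$-mosaic is a suitably connected and suitably $\partial$-connected $(m,n)$-mosaic. $D_P^{(m,n)}$ denotes the number of period knot $(m,n)$-mosaics. $\mathrm{tr}$ denotes the trace. *)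

(* Defs.v *)
From mathcomp Require Import all_boot all_order all_algebra.

Set Implicit Arguments.
Unset Strict Implicit.
Unset Printing Implicit Defensive.

Import GRing.Theory.

(* The ordinal [i : 'I_11] stands for the mosaic tile T_i. *)
Definition tile := 'I_11.

Inductive edge := Left | Right | Top | Bottom.

(* Only the connection points of a tile matter here; T_7, ..., T_10 are
   distinct tiles that all have connection points on the four edges. *)
Definition connection_point (t : tile) (e : edge) : bool :=
  match nat_of_ord t, e with
  | 1, (Left | Bottom)
  | 2, (Right | Bottom)
  | 3, (Right | Top)
  | 4, (Left | Top)
  | 5, (Left | Right)
  | 6, (Top | Bottom)
  | (7 | 8 | 9 | 10), _ => true
  | _, _ => false
  end.

(* Row 0 is at the top and column 0 at the left. *)
Definition mosaic (m n : nat) := 'M[tile]_(m, n).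

Definition suitably_connected (m n : nat) (M : mosaic m n) : bool :=
  [forall i : 'I_m, forall j : 'I_n, forall j' : 'I_n, (j' == j.+1 :> nat) ==>
     (connection_point (M i j) Right == connection_point (M i j') Left)] &&
  [forall j : 'I_n, forall i : 'I_m, forall i' : 'I_m, (i' == i.+1 :> nat) ==>
     (connection_point (M i j) Bottom == connection_point (M i' j) Top)].

Definition suitably_bd_connected (m n : nat) (M : mosaic m n) : bool :=
  [forall i : 'I_m, forall j : 'I_n, forall j' : 'I_n,
     (j == 0 :> nat) && (j'.+1 == n) ==>
     (connection_point (M i j) Left == connection_point (M i j') Right)] &&
  [forall j : 'I_n, forall i : 'I_m, forall i' : 'I_m,
     (i == 0 :> nat) && (i'.+1 == m) ==>
     (connection_point (M i j) Top == connection_point (M i' j) Bottom)].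

Definition period_knot_mosaic (m n : nat) (M : mosaic m n) : bool :=
  suitably_connected M && suitably_bd_connected M.

Definition D_P (m n : nat) : nat :=
  #|[set M : mosaic m n | period_knot_mosaic M]|.

Local Open Scope ring_scope.

Lemma exp2S (k : nat) : (2 ^ k + 2 ^ k = 2 ^ k.+1)%N.
Proof. by rewrite expnS mul2n addnn. Qed.

(* [block_mx] has size [2 ^ k + 2 ^ k], which is not convertible to
   [2 ^ k.+1]. *)
Definition block2 (k : nat) (A B C D : 'M[int]_(2 ^ k)) : 'M[int]_(2 ^ k.+1) :=
  castmx (exp2S k, exp2S k) (block_mx A B C D).

Fixpoint Xplus (k : nat) : 'M[int]_(2 ^ k) :=
  match k return 'M[int]_(2 ^ k) with
  | 0 => const_mx 1
  | k'.+1 => block2 (Xplus k') (Ominus k') (Ominus k') (Xplus k')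
  end
with Ominus (k : nat) : 'M[int]_(2 ^ k) :=
  match k return 'M[int]_(2 ^ k) with
  | 0 => const_mx 0
  | k'.+1 => block2 (Ominus k') (Xplus k') (Xplus k') (4 *: Ominus k')
  end.

Fixpoint Xminus (k : nat) : 'M[int]_(2 ^ k) :=
  match k return 'M[int]_(2 ^ k) with
  | 0 => const_mx 0
  | k'.+1 => block2 (Xminus k') (Oplus k') (Oplus k') (Xminus k')
  end
with Oplus (k : nat) : 'M[int]_(2 ^ k) :=
  match k return 'M[int]_(2 ^ k) with
  | 0 => const_mx 1
  | k'.+1 => block2 (Oplus k') (Xminus k') (Xminus k') (4 *: Oplus k')
  end.

(* Main.v *)
Require Import Defs.
From mathcomp Require Import all_boot all_order all_algebra.

Set Implicit Arguments.
Unset Strict Implicit.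
Unset Printing Implicit Defensive.

Import GRing.Theory.

Local Open Scope ring_scope.

(** Gluing the right side of the rectangle to its left side, and the bottom to
the top, turns a period knot mosaic into a tiling of a torus.  Label each
vertical edge of the torus by a boolean h and each horizontal edge by a boolean
v, saying whether a curve crosses it.  A period knot mosaic determines its
labelling, and once a labelling is fixed the tiles can be chosen independently;
so the mosaics are counted by the sum over all labellings of the product over
the cells of the number of tiles that fit there ([D_P_labellings],
[card_fits]).  That number, [weight], is 0 if the cell has an odd number of
crossed edges, 4 if all its edges are crossed, and 1 otherwise.

This state sum is evaluated by transfer matrices in both directions, with the
same tool: the trace of a product of matrices is the sum over closed sequences
of indices of the products of entries ([tr_prod_cyclic]).

- Inside a column whose left and right labels are f and g, the sum over the
  horizontal labels v is the trace of a product of 2 x 2 matrices, one for each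
  row, indexed by the labels of the top and bottom edges of the cell.  The four
  entries of this product, as functions of f and g, are the matrices X and O
  with signs: the recursion is the expansion of the product along its first
  factor ([column_entries]).  The trace keeps X+ and O+, the entries for which
  the top and the bottom of the column agree ([transfer_entry]).
- Across the columns, the sum over h is then the trace of the n-th power of
  X+ + O+.

The proof identifies the indices below 2 ^ m with the labellings of a column in
the way that suits the block recursion: the block is given by the label of the
top row, which is the row added last ([column_index]). *)

(** * Traces of products as sums over closed sequences of indices *)

Section CyclicTrace.
Variables (R : comPzRingType) (d : nat) (T : finType) (e : T -> 'I_d).
Hypothesis e_bij : bijective e.

Lemma sum_tuple_cons n (G : n.+1.-tuple T -> R) :
  \sum_(t : n.+1.-tuple T) G t =
  \sum_(x : T) \sum_(t : n.-tuple T) G [tuple of x :: t].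
Proof.
rewrite pair_big.
rewrite (reindex (fun p : T * n.-tuple T => [tuple of p.1 :: p.2])) //=.
exists (fun t : n.+1.-tuple T => (thead t, [tuple of behead t])).
  by move=> [x t] _ /=; congr pair; apply: val_inj.
by move=> t _; rewrite [RHS]tuple_eta.
Qed.

(** The paths from x to y with n inner vertices t: the j-th step goes from the
j-th entry of x :: t to the j-th entry of t followed by y.  The default x0 is
never reached. *)
Lemma prod_mx_entry n (F : 'I_n.+1 -> 'M[R]_d) (x y x0 : T) :
  (\prod_(j < n.+1) F j) (e x) (e y) =
  \sum_(t : n.-tuple T) \prod_(j < n.+1)
     F j (e (nth x0 (x :: t) j)) (e (nth x0 (rcons t y) j)).
Proof.
elim: n F x => [|n IHn] F x.
  rewrite big_ord1 (big_pred1 [tuple]) => [|t]; first by rewrite big_ord1.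
  by apply/esym/eqP; apply: tuple0.
rewrite big_ord_recl mxE (reindex e) /=; last exact: onW_bij.
rewrite sum_tuple_cons; apply: eq_bigr => z _.
rewrite IHn mulr_sumr; apply: eq_bigr => t _.
by rewrite [RHS]big_ord_recl.
Qed.

(** For a closed path the tail [rcons t x] is the rotation of [x :: t], so the
successor of a vertex is the one at the cyclically next position. *)
Lemma tr_prod_tuple n (F : 'I_n -> 'M[R]_d) : (0 < n)%N ->
  \tr (\prod_(j < n) F j) =
  \sum_(t : n.-tuple T) \prod_(j < n) F j (e (tnth t j)) (e (tnth t (ordS j))).
Proof.
case: n F => // n F _.
rewrite sum_tuple_cons /mxtrace (reindex e) /=; last exact: onW_bij.
apply: eq_bigr => x _; rewrite (prod_mx_entry _ _ _ x).
apply: eq_bigr => t _; apply: eq_bigr => j _.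
rewrite !(tnth_nth x) /=; congr (F j (e _) (e _)).
have := ltn_ord j; rewrite ltnS leq_eqVlt => /orP[/eqP ->|ltjn].
  by rewrite modnn /= nth_rcons size_tuple ltnn eqxx.
by rewrite modn_small //= nth_rcons size_tuple ltjn.
Qed.

(** Finite functions in place of tuples, since distributing a product over sums
produces sums over finite functions. *)
Lemma tr_prod_cyclic n (F : 'I_n -> 'M[R]_d) : (0 < n)%N ->
  \tr (\prod_(j < n) F j) =
  \sum_(f : {ffun 'I_n -> T}) \prod_(j < n) F j (e (f j)) (e (f (ordS j))).
Proof.
move=> n_gt0; rewrite tr_prod_tuple //.
rewrite (reindex (fun f : {ffun 'I_n -> T} => [tuple f i | i < n])) /=.
  apply: eq_bigr => f _; apply: eq_bigr => j _.
  by rewrite !tnth_mktuple.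
exists (fun t : n.-tuple T => [ffun i => tnth t i]) => [f _|t _].
  by apply/ffunP => i; rewrite ffunE tnth_mktuple.
by apply: eq_from_tnth => i; rewrite tnth_mktuple ffunE.
Qed.

End CyclicTrace.

(** * Labellings of a column as indices of block matrices *)

Definition block_index k (b : bool) (i : 'I_(2 ^ k)) : 'I_(2 ^ k.+1) :=
  cast_ord (exp2S k) (if b then rshift _ i else lshift _ i).

Lemma block_index_inj k b c (i j : 'I_(2 ^ k)) :
  block_index b i = block_index c j -> b = c /\ i = j.
Proof.
move/cast_ord_inj; case: b; case: c => /eqP.
- by rewrite (inj_eq (@rshift_inj _ _)) => /eqP.
- by rewrite eq_rlshift.
- by rewrite eq_lrshift.
- by rewrite (inj_eq (@lshift_inj _ _)) => /eqP.
Qed.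

Lemma block2E k (A B C D : 'M[int]_(2 ^ k)) b c i j :
  block2 A B C D (block_index b i) (block_index c j) =
  (if b then if c then D else C else if c then B else A) i j.
Proof.
rewrite /block2 castmxE /block_index !cast_ordK.
case: b; case: c.
- exact: block_mxEdr.
- exact: block_mxEdl.
- exact: block_mxEur.
- exact: block_mxEul.
Qed.

(** Row 0 selects the outermost block. *)
Fixpoint column_index k : ('I_k -> bool) -> 'I_(2 ^ k) :=
  match k return ('I_k -> bool) -> 'I_(2 ^ k) with
  | 0 => fun=> ord0
  | k'.+1 => fun f =>
      block_index (f ord0) (column_index (fun i => f (lift ord0 i)))
  end.

Lemma column_index_inj k (f g : 'I_k -> bool) :
  column_index f = column_index g -> f =1 g.
Proof.
elim: k f g => [|k IHk] f g /=; first by move=> _ [].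
move/block_index_inj => [fg0 /IHk fgS] i.
by case: (unliftP ord0 i) => [j ->|->]; [apply: fgS|].
Qed.

Lemma column_index_bij k :
  bijective (fun f : {ffun 'I_k -> bool} => column_index f).
Proof.
apply: inj_card_bij => [f g /column_index_inj fg|]; first exact/ffunP.
by rewrite card_ffun card_bool !card_ord.
Qed.

(** * The transfer matrix of a column *)

Definition tile_with (l r t b : bool) : pred tile := fun x =>
  [&& connection_point x Left == l, connection_point x Right == r,
      connection_point x Top == t & connection_point x Bottom == b].

Definition weight (l r t b : bool) : int := #|tile_with l r t b|%:Z.

(** Each even set of edges belongs to exactly one tile, except the full set,
which belongs to four. *)
Lemma weightE l r t b :
  weight l r t b =
  if l (+) r (+) t (+) b then 0 else if [&& l, r, t & b] then 4 else 1.
Proof.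
rewrite /weight -sum1_card big_mkcond !big_ord_recl big_ord0 /=.
by move: l r t b => [] [] [] [].
Qed.

Definition index2 (b : bool) : 'I_2 := if b then 1 else 0.

Lemma index2_bij : bijective index2.
Proof.
by exists (fun x => x == 1) => [[]|[[|[|x]] lt_x2]] //; apply: val_inj.
Qed.

(** Rows are indexed by the top edge and columns by the bottom edge, so that
matrix products stack cells from top to bottom. *)
Definition tile_mx (l r : bool) : 'M[int]_2 :=
  \matrix_(x, y) weight l r (x == 1) (y == 1).

Lemma tile_mxE l r t b : tile_mx l r (index2 t) (index2 b) = weight l r t b.
Proof. by rewrite mxE; case: t; case: b. Qed.

(** The letter X or O tells whether the top label of the column is 0 or 1, and
the sign tells whether the bottom label is equal to it.  Since the top tile
must have an even number of crossed edges, its left, right and top labels leave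
a single possible bottom label, so each block of the recursion has one term.
The factor 4 counts the tiles with all their edges crossed. *)
Lemma column_entries k (f g : 'I_k -> bool) :
  let P := \prod_(i < k) tile_mx (f i) (g i) in
  let x := column_index f in let y := column_index g in
  [/\ P (index2 false) (index2 false) = Xplus k x y,
      P (index2 true) (index2 false) = Ominus k x y,
      P (index2 false) (index2 true) = Xminus k x y &
      P (index2 true) (index2 true) = Oplus k x y].
Proof.
elim: k f g => [|k IHk] f g P x y; rewrite {}/P {}/x {}/y;
  first by rewrite big_ord0 !mxE.
have [XP OM XM OP] := IHk (fun i => f (lift ord0 i)) (fun i => g (lift ord0 i)).
have step t s : (\prod_(i < k.+1) tile_mx (f i) (g i)) (index2 t) (index2 s) =
    \sum_(u : bool) weight (f ord0) (g ord0) t u *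
      (\prod_(i < k) tile_mx (f (lift ord0 i)) (g (lift ord0 i)))
        (index2 u) (index2 s).
  rewrite big_ord_recl mxE (reindex index2) /=; last exact/onW_bij/index2_bij.
  by apply: eq_bigr => u _; rewrite tile_mxE.
rewrite !step !big_bool XP OM XM OP !weightE /= !block2E.
by case: (f ord0); case: (g ord0);
  rewrite /= ?mxE !(mul0r, mul1r, addr0, add0r).
Qed.

(** Closing the column up makes its top and bottom labels equal, which is the
trace of the product of tile matrices, hence X+ plus O+. *)
Lemma transfer_entry m (f g : 'I_m -> bool) : (0 < m)%N ->
  (Xplus m + Oplus m) (column_index f) (column_index g) =
  \sum_(v : {ffun 'I_m -> bool})
     \prod_(i < m) weight (f i) (g i) (v i) (v (ordS i)).
Proof.
move=> m_gt0; have [XP _ _ OP] := column_entries f g.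
rewrite mxE -XP -OP.
transitivity (\tr (\prod_(i < m) tile_mx (f i) (g i))).
  by rewrite /mxtrace (reindex index2) ?big_bool 1?addrC //;
    apply/onW_bij/index2_bij.
rewrite (tr_prod_cyclic index2_bij) //.
by apply: eq_bigr => v _; apply: eq_bigr => i _; rewrite tile_mxE.
Qed.

(** * Mosaics on the torus *)

(** The conditions inside and at the boundary of a line of tiles are together
the gluing condition on a circle. *)
Lemma cyclic_gluing n (a b : 'I_n -> bool) :
  [forall j, a j == b (ordS j)] =
  [forall j : 'I_n, forall j' : 'I_n, (j' == j.+1 :> nat) ==> (a j == b j')] &&
  [forall j : 'I_n, forall j' : 'I_n,
     (j == 0 :> nat) && (j'.+1 == n) ==> (b j == a j')].
Proof.
apply/forallP/andP => [ab|[/forallP abS /forallP ab0] j].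
  split; apply/forallP => j; apply/forallP => j'; apply/implyP.
    move/eqP => j'E; rewrite (eqP (ab j)); apply/eqP; congr b; apply: val_inj.
    by rewrite /= -j'E modn_small.
  move=> /andP[/eqP j0 /eqP j'n]; rewrite (eqP (ab j')); apply/eqP; congr b.
  by apply: val_inj; rewrite /= j'n modnn.
have [jn|jn] := eqVneq j.+1 n.
  have := forallP (ab0 (ordS j)) j; rewrite /= jn modnn !eqxx /=.
  by rewrite eq_sym.
apply: (implyP (forallP (abS j) (ordS j))) => /=.
by rewrite modn_small // ltn_neqAle jn ltn_ord.
Qed.

Lemma period_knot_mosaicE m n (M : mosaic m n) :
  period_knot_mosaic M =
  [forall j, forall i,
     (connection_point (M i j) Right == connection_point (M i (ordS j)) Left) &&
     (connection_point (M i j) Bottom == connection_point (M (ordS i) j) Top)].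
Proof.
rewrite /period_knot_mosaic /suitably_connected /suitably_bd_connected.
rewrite andbACA.
have forallI k (P Q : pred 'I_k) :
    [forall i, P i] && [forall i, Q i] = [forall i, P i && Q i].
  apply/andP/forallP => [[/forallP p /forallP q] i|pq]; first by rewrite p q.
  by split; apply/forallP => i; case/andP: (pq i).
rewrite !forallI.
transitivity ([forall i, forall j, connection_point (M i j) Right ==
                connection_point (M i (ordS j)) Left] &&
              [forall j, forall i, connection_point (M i j) Bottom ==
                connection_point (M (ordS i) j) Top]).
  congr (_ && _); apply: eq_forallb => i.
    by rewrite (cyclic_gluing (fun j => connection_point (M i j) Right)
                 (fun j => connection_point (M i j) Left)).
  by rewrite (cyclic_gluing (fun j => connection_point (M j i) Bottom)
                 (fun j => connection_point (M j i) Top)).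
have -> : [forall i, forall j, connection_point (M i j) Right ==
                connection_point (M i (ordS j)) Left] =
   [forall j, forall i, connection_point (M i j) Right ==
                connection_point (M i (ordS j)) Left].
  by apply/forallP/forallP => h i; apply/forallP => j; apply: (forallP (h j)).
by rewrite forallI; apply: eq_forallb => j; rewrite forallI.
Qed.

Definition labelling m n := {ffun 'I_n -> {ffun 'I_m -> bool}}.

(** The right edge of a cell is the left edge of the next one, and its bottom
edge is the top edge of the one below, both cyclically. *)
Definition fits m n (h v : labelling m n) (M : mosaic m n) : bool :=
  [forall j, forall i,
     tile_with (h j i) (h (ordS j) i) (v j i) (v j (ordS i)) (M i j)].

(** The tiles of the cells are chosen independently of one another. *)
Lemma card_fits m n (h v : labelling m n) :
  #|fits h v|%:Z =
  \prod_(j < n) \prod_(i < m)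
     weight (h j i) (h (ordS j) i) (v j i) (v j (ordS i)).
Proof.
pose F (j : 'I_n) (i : 'I_m) :=
  tile_with (h j i) (h (ordS j) i) (v j i) (v j (ordS i)).
pose G (p : 'I_m * 'I_n) := F p.2 p.1.
transitivity (#|family G|%:Z).
  congr Posz; pose mos (f : {ffun 'I_m * 'I_n -> tile}) : mosaic m n :=
    \matrix_(i, j) f (i, j).
  have mos_inj : injective mos.
    move=> f g /matrixP fg; apply/ffunP => -[i j]; have := fg i j.
    by rewrite !mxE.
  rewrite -(card_image mos_inj); apply: eq_card => M; rewrite [LHS]unfold_in.
  apply/idP/imageP => [/forallP hM|[f /familyP hf ->]].
    exists [ffun p => M p.1 p.2].
      by apply/familyP => -[i j]; rewrite ffunE; apply: (forallP (hM j)).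
    by apply/matrixP => i j; rewrite mxE ffunE.
  apply/forallP => j; apply/forallP => i; rewrite mxE.
  exact: (hf (i, j)).
rewrite card_family foldrE big_image /= -natz natr_prod.
rewrite exchange_big pair_big /=.
by apply: eq_bigr => p _; rewrite natz.
Qed.

(** A mosaic fits at most one labelling, read off from the left and top edges
of its tiles, and it fits that one exactly when the gluing conditions hold. *)
Lemma D_P_labellings m n :
  (D_P m n)%:Z =
  \sum_(h : labelling m n) \sum_(v : labelling m n) #|fits h v|%:Z.
Proof.
pose edges (M : mosaic m n) : labelling m n * labelling m n :=
  ([ffun j => [ffun i => connection_point (M i j) Left]],
   [ffun j => [ffun i => connection_point (M i j) Top]]).
rewrite pair_big /D_P -sum1_card (partition_big edges xpredT) //=.
rewrite -natz natr_sum.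
apply: eq_bigr => -[h v] _; rewrite natz -sum1_card; congr Posz.
apply: eq_bigl => M; rewrite !inE period_knot_mosaicE.
apply/andP/forallP => [[/forallP glue /eqP[<- <-]] j|fit].
  apply/forallP => i; rewrite /tile_with !ffunE !eqxx /=.
  by have /andP[-> /eqP ->] := forallP (glue j) i; rewrite eqxx.
have fitE j i : tile_with (h j i) (h (ordS j) i) (v j i) (v j (ordS i)) (M i j).
  exact: (forallP (fit j)).
split.
  apply/forallP => j; apply/forallP => i.
  have /and4P[_ /eqP -> _ /eqP ->] := fitE j i.
  have /and4P[/eqP -> _ _ _] := fitE (ordS j) i.
  by have /and4P[_ _ /eqP -> _] := fitE j (ordS i); rewrite !eqxx.
apply/eqP; congr pair; apply/ffunP => j; apply/ffunP => i; rewrite !ffunE.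
  by have /and4P[/eqP -> _ _ _] := fitE j i.
by have /and4P[_ _ /eqP -> _] := fitE j i.
Qed.

Theorem theorem2 (m n : nat) (hm : (0 < m)%N) (hn : (0 < n)%N) :
  (D_P m n)%:Z = \tr ((Xplus m + Oplus m) ^+ n).
Proof.
have -> : (Xplus m + Oplus m) ^+ n = \prod_(j < n) (Xplus m + Oplus m).
  by rewrite prodr_const card_ord.
rewrite (tr_prod_cyclic (@column_index_bij m)) // D_P_labellings.
apply: eq_bigr => h _.
under [RHS]eq_bigr do rewrite transfer_entry //.
(* Choosing the horizontal labels column by column is choosing all of them. *)
rewrite bigA_distr_bigA /=; apply: eq_bigr => v _.
exact: card_fits.
Qed.
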